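(* Let $I\subsetneq E$ be a monomial ideal of $E=K\langle e_1,\dots,e_n\rangle$ with linear quotients with respect to the degree increasing order $u_1,\dots,u_r$ of the minimal monomial generators of $I$, and let $F$ be the iterated mapping cone derived from the sequence $u_1,\dots,u_r$. Then $F$ is a minimal graded free resolution of $E/I$, and for all $i>0$ the free $E$-module $F_i$ which appears in the $i$th step of $F$ has a homogeneous basis $$\{f(a;u)\ :\ u\in G(I),\ a\in\mathbb{N}^n,\ \mathrm{supp}(a)\subseteq \mathrm{set}(u),\ |a|=i-1\}$$ with $\deg f(a;u)=|a|+\deg u$.
   Context: $K$ is a field, $E=K\langle e_1,\dots,e_n\rangle$ is the exterior algebra of a $K$-vector space with basis $e_1,\dots,e_n$, standard graded; products are written by juxtaposition. A monomial is $e_\mu=e_{i_1}\cdots e_{i_d}$ for $\mu=\{i_1<\dots<i_d\}\subseteq[n]=\{1,\dots,n\}$ (up to sign), with $\mathrm{supp}(e_\mu)=\mu$. A monomial ideal is an ideal generated by monomials; $G(I)$ is its unique minimal set of monomial generators. $\mathbb{N}$ is the set of non-negative integers; for $a=(a_1,\dots,a_n)\in\mathbb{N}^n$, $|a|=a_1+\dots+a_n$ and $\mathrm{supp}(a)=\{j:a_j\neq0\}$. For an ideal $J$ and a monomial $u$, $J:(u)=\{x\in E: xu\in J\}$. Linear quotients: $I$ has linear quotients with respect to an order $u_1,\dots,u_r$ of $G(I)$ if $0:(u_1)$ and $(u_1,\dots,u_{j-1}):(u_j)$, $j=2,\dots,r$, are each generated by a subset of $\{e_1,\dots,e_n\}$.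 The order is degree increasing if $\deg u_1\le\dots\le\deg u_r$. One sets $\mathrm{set}(u_j)=\{k\in[n]: e_k\in(u_1,\dots,u_{j-1}):(u_j)\}$ for $j\geq 2$, and $\mathrm{set}(u_1)=\{k\in[n]:e_k\in 0:(u_1)\}=\mathrm{supp}(u_1)$. Cartan complex: for a sequence $v=v_1,\dots,v_m$ of linear forms, $C_\cdot(v;E)$ has $i$-chains $C_i=\bigoplus_{a\in\mathbb{N}^m,|a|=i}E\,x^{(a)}$, where $x^{(a)}=x_1^{(a_1)}\cdots x_m^{(a_m)}$ are the divided power monomials in $m$ variables, with $E$-linear differential $\partial(x^{(a)})=\sum_{i=1}^m v_i\,x_1^{(a_1)}\cdots x_i^{(a_i-1)}\cdots x_m^{(a_m)}$ (terms with negative exponent are $0$). It is a minimal free resolution of $E/(v)$ when $v$ is a subset of the variables $e_1,\dots,e_n$. Iterated mapping cone: put $I_0=0$, $I_j=(u_1,\dots,u_j)$, $L_j=I_j:(u_{j+1})$, which is generated by the $e_k$ with $k\in\mathrm{set}(u_{j+1})$. There are exact sequences $0\to E/L_j\xrightarrow{\alpha}E/I_j\to E/I_{j+1}\to0$ with $\alpha$ multiplication by $u_{j+1}$. Let $F^{(0)}$ be $E$ concentrated in homological degree $0$. Given a graded free resolution $F^{(j)}$ of $E/I_j$, let $C^{(j)}$ be the Cartan complex of the sequence $(e_k)_{k\in\mathrm{set}(u_{j+1})}$ (graded so that $x^{(a)}$ has degree $|a|+\deg u_{j+1}$), let $\psi^{(j)}:C^{(j)}\to F^{(j)}$ be a homogeneous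 (degree $0$) chain map lifting $\alpha$, and let $F^{(j+1)}$ be its mapping cone: $F^{(j+1)}_0=F^{(j)}_0$, $F^{(j+1)}_i=C^{(j)}_{i-1}\oplus F^{(j)}_i$ for $i>0$, with the differential given on $C^{(j)}_{i-1}$ by $(-d^{C^{(j)}}_{i-1},\psi^{(j)}_{i-1})$ (only $\psi^{(j)}_0$ for $i=1$) and on $F_i^{(j)}$ by $d_i^{F^{(j)}}$. Then $F^{(j+1)}$ is a graded free resolution of $E/I_{j+1}$, and $F=F^{(r)}$ is the iterated mapping cone derived from $u_1,\dots,u_r$. The basis element $x^{(a)}$ of $C^{(j)}$ is denoted $f(a;u_{j+1})$, where $a$ is regarded as an element of $\mathbb{N}^n$ supported in $\mathrm{set}(u_{j+1})$. A graded free resolution is minimal if the image of each differential $F_i\to F_{i-1}$, $i\ge1$, lies in $(e_1,\dots,e_n)F_{i-1}$. *)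

(* Defs.v *)
From HB Require Import structures.
From mathcomp Require Import all_boot all_order all_algebra.
From mathcomp Require Import boolp.
From mathcomp Require Import mpoly.

Set Implicit Arguments.
Unset Strict Implicit.
Unset Printing Implicit Defensive.

Import GRing.Theory.
Local Open Scope ring_scope.

(** * The exterior algebra [K<e_1, ..., e_n>]

    Underlying space: free on the subsets [A] of ['I_n], the basis vector [A]
    standing for [e_{i_1} ... e_{i_d}], [A = {i_1 < ... < i_d}]. *)

Definition exterior (K : fieldType) (n : nat) : Type := {ffun {set 'I_n} -> K^o}.

HB.instance Definition _ (K : fieldType) (n : nat) :=
  GRing.Lmodule.copy (exterior K n) {ffun {set 'I_n} -> K^o}.

Section ExteriorAlgebra.
Variables (K : fieldType) (n : nat).
Local Notation E := (exterior K n).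
Implicit Types (A B C : {set 'I_n}) (x y z : E).

Definition ecoef x A : K := (x : {ffun {set 'I_n} -> K^o}) A.

Definition emono A : E := [ffun B => (B == A)%:R : K^o].

Definition evar (k : 'I_n) : E := emono [set k].

(* number of transpositions needed to sort the concatenation of A and B *)
Definition ninv A B : nat := (\sum_(a in A) \sum_(b in B) (b < a))%N.

Definition mono_mul A B : E :=
  if [disjoint A & B] then ((-1) ^+ ninv A B : K) *: emono (A :|: B) else 0.

Definition emul x y : E :=
  \sum_A \sum_B (ecoef x A * ecoef y B) *: mono_mul A B.

Lemma ecoefD x y A : ecoef (x + y) A = ecoef x A + ecoef y A.
Proof. by rewrite /ecoef ffunE. Qed.

Lemma ecoefZ (c : K) x A : ecoef (c *: x) A = c * ecoef x A.
Proof. by rewrite /ecoef ffunE. Qed.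

Lemma ecoef_mono A B : ecoef (emono A) B = (B == A)%:R.
Proof. by rewrite /ecoef ffunE. Qed.

Lemma ecoef_sum (I : Type) (r : seq I) (P : pred I) (F : I -> E) A :
  ecoef (\sum_(i <- r | P i) F i) A = \sum_(i <- r | P i) ecoef (F i) A.
Proof. by rewrite /ecoef sum_ffunE. Qed.

Lemma extP x y : (forall A, ecoef x A = ecoef y A) -> x = y.
Proof. by move=> h; apply/ffunP. Qed.

Lemma mono_decomp x : x = \sum_A ecoef x A *: emono A.
Proof.
apply/extP => B; rewrite ecoef_sum (bigD1 B) //= ecoefZ ecoef_mono eqxx mulr1.
rewrite big1 ?addr0 // => A neAB.
by rewrite ecoefZ ecoef_mono eq_sym (negbTE neAB) mulr0.
Qed.

Lemma emulDl : left_distributive emul +%R.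
Proof.
move=> x y z; rewrite /emul -big_split; apply: eq_bigr => A _ /=.
rewrite -big_split; apply: eq_bigr => B _ /=.
by rewrite ecoefD mulrDl scalerDl.
Qed.

Lemma emulDr : right_distributive emul +%R.
Proof.
move=> x y z; rewrite /emul -big_split; apply: eq_bigr => A _ /=.
rewrite -big_split; apply: eq_bigr => B _ /=.
by rewrite ecoefD mulrDr scalerDl.
Qed.

Lemma emulZl (c : K) x y : emul (c *: x) y = c *: emul x y.
Proof.
rewrite /emul scaler_sumr; apply: eq_bigr => A _.
rewrite scaler_sumr; apply: eq_bigr => B _.
by rewrite ecoefZ -mulrA scalerA.
Qed.

Lemma emulZr (c : K) x y : emul x (c *: y) = c *: emul x y.
Proof.
rewrite /emul scaler_sumr; apply: eq_bigr => A _.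
rewrite scaler_sumr; apply: eq_bigr => B _.
by rewrite ecoefZ mulrCA scalerA.
Qed.

Lemma emul_suml (I : Type) (r : seq I) (P : pred I) (F : I -> E) y :
  emul (\sum_(i <- r | P i) F i) y = \sum_(i <- r | P i) emul (F i) y.
Proof.
apply: (big_morph (emul^~ y)) => [u v|]; first exact: emulDl.
by rewrite -(scale0r (0 : E)) emulZl !scale0r.
Qed.

Lemma emul_sumr (I : Type) (r : seq I) (P : pred I) (F : I -> E) x :
  emul x (\sum_(i <- r | P i) F i) = \sum_(i <- r | P i) emul x (F i).
Proof.
apply: (big_morph (emul x)) => [u v|]; first exact: emulDr.
by rewrite -(scale0r (0 : E)) emulZr !scale0r.
Qed.

Lemma emul_mono A B : emul (emono A) (emono B) = mono_mul A B.
Proof.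
rewrite /emul (bigD1 A) //= (bigD1 B) //= !ecoef_mono !eqxx mulr1 scale1r.
rewrite !big1 ?addr0 // => [C neC|C neC].
  by rewrite big1 // => D _; rewrite ecoef_mono (negbTE neC) mul0r scale0r.
by rewrite !ecoef_mono (negbTE neC) mulr0 scale0r.
Qed.

Lemma ninvUl A B C : [disjoint A & B] ->
  ninv (A :|: B) C = (ninv A C + ninv B C)%N.
Proof.
by move=> dAB; rewrite /ninv -bigU //; apply: eq_bigl => k; rewrite !inE.
Qed.

Lemma ninvUr A B C : [disjoint B & C] ->
  ninv A (B :|: C) = (ninv A B + ninv A C)%N.
Proof.
move=> dBC; rewrite /ninv -big_split; apply: eq_bigr => a _ /=.
by rewrite -bigU //; apply: eq_bigl => k; rewrite !inE.
Qed.

Lemma mono_mulA A B C :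
  emul (emono A) (mono_mul B C) = emul (mono_mul A B) (emono C).
Proof.
have e0l z : emul 0 z = 0 by rewrite -(scale0r (0 : E)) emulZl !scale0r.
have e0r z : emul z 0 = 0 by rewrite -(scale0r (0 : E)) emulZr !scale0r.
rewrite {1}/mono_mul; case: (boolP [disjoint B & C]) => dBC; last first.
  rewrite e0r {1}/mono_mul; case: ifP => dAB; last by rewrite e0l.
  rewrite emulZl emul_mono /mono_mul ifF ?scaler0 //.
  by rewrite -setI_eq0 setIUl setU_eq0 !setI_eq0 (negbTE dBC) andbF.
rewrite emulZr emul_mono {1 2}/mono_mul; case: (boolP [disjoint A & B]) => dAB.
  rewrite emulZl emul_mono /mono_mul.
  have -> : [disjoint A :|: B & C] = [disjoint A & C].
    by rewrite -setI_eq0 setIUl setU_eq0 !setI_eq0 dBC andbT.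
  have -> : [disjoint A & B :|: C] = [disjoint A & C].
    by rewrite -setI_eq0 setIUr setU_eq0 !setI_eq0 dAB.
  case: ifP => dAC; last by rewrite !scaler0.
  rewrite !scalerA -!exprD ninvUl // ninvUr // setUA; congr ((_ ^+ _) *: _).
  by rewrite addnC -addnA.
rewrite ifF ?scaler0 ?e0l //.
by rewrite -setI_eq0 setIUr setU_eq0 !setI_eq0 (negbTE dAB).
Qed.

Lemma emulA : associative emul.
Proof.
move=> x y z; rewrite (mono_decomp x) [emul _ y]emul_suml !emul_suml; apply: eq_bigr => A _.
rewrite !emulZl; congr (_ *: _).
rewrite (mono_decomp y) [in LHS]emul_suml [in LHS]emul_sumr.
rewrite [in RHS]emul_sumr emul_suml; apply: eq_bigr => B _.
rewrite !(emulZl, emulZr); congr (_ *: _).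
rewrite (mono_decomp z) [emul (emono B) _]emul_sumr !emul_sumr; apply: eq_bigr => C _.
by rewrite !emulZr (emul_mono A B) (emul_mono B C) mono_mulA.
Qed.

Lemma emul1l : left_id (emono set0) emul.
Proof.
move=> x; rewrite {1}(mono_decomp x) emul_sumr [RHS]mono_decomp.
apply: eq_bigr => A _; rewrite emulZr emul_mono /mono_mul -setI_eq0 set0I eqxx.
by rewrite /ninv big_set0 expr0 scale1r set0U.
Qed.

Lemma emul1r : right_id (emono set0) emul.
Proof.
move=> x; rewrite {1}(mono_decomp x) emul_suml [RHS]mono_decomp.
apply: eq_bigr => A _; rewrite emulZl emul_mono /mono_mul -setI_eq0 setI0 eqxx.
by rewrite /ninv big1 ?expr0 ?scale1r ?setU0 // => a _; rewrite big_set0.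
Qed.

Lemma mono0_neq0 : emono set0 != 0.
Proof.
apply/eqP => /(congr1 (ecoef^~ set0)).
by rewrite ecoef_mono eqxx /ecoef ffunE; apply/eqP; rewrite oner_eq0.
Qed.

End ExteriorAlgebra.

HB.instance Definition _ (K : fieldType) (n : nat) :=
  GRing.Zmodule_isNzRing.Build (exterior K n) (@emulA K n) (@emul1l K n)
    (@emul1r K n) (@emulDl K n) (@emulDr K n) (@mono0_neq0 K n).

HB.instance Definition _ (K : fieldType) (n : nat) :=
  GRing.Lmodule_isLalgebra.Build K (exterior K n)
    (fun c x y => esym (emulZl c x y)).

HB.instance Definition _ (K : fieldType) (n : nat) :=
  GRing.Lalgebra_isAlgebra.Build K (exterior K n)
    (fun c x y => esym (emulZr c x y)).

Section ExteriorSanity.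
Variables (K : fieldType) (n : nat).

Lemma mono_mulE (A B : {set 'I_n}) : emono K A * emono K B = mono_mul K A B.
Proof. exact: emul_mono. Qed.

Lemma evar_sqr (k : 'I_n) : evar K k * evar K k = 0.
Proof. by rewrite mono_mulE /mono_mul -setI_eq0 setIid -cards_eq0 cards1. Qed.

Lemma evar_anticomm (j k : 'I_n) : evar K j * evar K k = - (evar K k * evar K j).
Proof.
rewrite !mono_mulE /mono_mul /ninv !big_set1 !disjoints1 !inE eq_sym setUC.
case: (ltngtP j k) => [lt_jk|lt_kj|/val_inj->]; last by rewrite eqxx oppr0.
- by rewrite neq_ltn lt_jk orbT /= expr0 expr1 scaleN1r scale1r opprK.
- by rewrite neq_ltn lt_kj /= expr0 expr1 scaleN1r scale1r.
Qed.

Lemma mono_prod (A : {set 'I_n}) : emono K A = \prod_(k <- enum A) evar K k.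
Proof.
have pr (s : seq 'I_n) : sorted (fun j k : 'I_n => (j < k)%N) s ->
    \prod_(k <- s) evar K k = emono K [set k in s].
  elim: s => [_|k s IHs] /=.
    by rewrite big_nil; congr emono; apply/setP => k; rewrite !inE.
  rewrite path_sortedE; last by move=> ? ? ?; apply: ltn_trans.
  case/andP=> /allP ltk /IHs; rewrite big_cons => ->.
  rewrite mono_mulE /mono_mul disjoints1 inE ifT; last first.
    by apply: contraT => /negbNE/ltk; rewrite ltnn.
  rewrite set_cons /ninv big_set1 big1 ?expr0 ?scale1r // => j; rewrite inE.
  by move/ltk; rewrite ltnNge => /negbTE le_jk; rewrite ltn_neqAle le_jk andbF.
rewrite pr; first by congr emono; apply/setP => k; rewrite inE mem_enum.
rewrite /enum_mem sorted_filter //; first by move=> ? ? ?; apply: ltn_trans.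
have: sorted ltn (map val (enum 'I_n)) by rewrite val_enum_ord iota_ltn_sorted.
by rewrite sorted_map enumT.
Qed.

End ExteriorSanity.

Section Ideals.
Variables (K : fieldType) (n : nat).
Local Notation E := (exterior K n).

Definition ehomog (d : nat) (x : E) : Prop :=
  forall A, ecoef x A != 0 -> #|A| = d.

Record is_ideal (J : E -> Prop) : Prop := IsIdeal {
  ideal0 : J 0;
  idealD : forall x y, J x -> J y -> J (x + y);
  idealMl : forall a x, J x -> J (a * x);
  idealMr : forall a x, J x -> J (x * a) }.

Definition ideal_gen (G : E -> Prop) (x : E) : Prop :=
  forall J : E -> Prop, is_ideal J -> (forall g, G g -> J g) -> J x.

Definition mono_gen (M : {set {set 'I_n}}) : E -> Prop :=
  ideal_gen (fun g => exists2 u, u \in M & g = emono K u).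

Definition evar_gen (S : {set 'I_n}) : E -> Prop :=
  ideal_gen (fun g => exists2 k, k \in S & g = evar K k).

Definition monomial_ideal (J : E -> Prop) : Prop :=
  exists M : {set {set 'I_n}}, forall x, J x <-> mono_gen M x.

Definition min_mono_gens (J : E -> Prop) (M : {set {set 'I_n}}) : Prop :=
  (forall x, J x <-> mono_gen M x) /\
  (forall M' : {set {set 'I_n}}, M' \proper M ->
     ~ (forall x, J x <-> mono_gen M' x)).

Definition colon (J : E -> Prop) (u : E) (x : E) : Prop := J (x * u).

(* The sequence us lists u_1, ..., u_r, so that nth set0 us j is u_(j+1). *)

Definition partial_ideal (us : seq {set 'I_n}) (j : nat) : E -> Prop :=
  mono_gen [set u in take j us].

Definition linear_quotients (us : seq {set 'I_n}) : Prop :=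
  forall j, (j < size us)%N ->
  exists S : {set 'I_n}, forall x,
    colon (partial_ideal us j) (emono K (nth set0 us j)) x <-> evar_gen S x.

Definition degree_increasing (us : seq {set 'I_n}) : bool :=
  sorted (fun u v : {set 'I_n} => #|u| <= #|v|)%N us.

Definition lqset (us : seq {set 'I_n}) (u : {set 'I_n}) : {set 'I_n} :=
  [set k | `[< colon (partial_ideal us (index u us)) (emono K u) (evar K k) >]].

End Ideals.

Section GradedModules.
Variables (K : fieldType) (n : nat).
Local Notation E := (exterior K n).

Record is_grading (M : lmodType E) (hom : nat -> M -> Prop) : Prop := IsGrading {
  hom0 : forall d, hom d 0;
  homD : forall d x y, hom d x -> hom d y -> hom d (x + y);
  homZ : forall p q c x, ehomog p c -> hom q x -> hom (p + q)%N (c *: x);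
  hom_decomp : forall x, exists (N : nat) (y : nat -> M),
    (forall d, hom d (y d)) /\ x = \sum_(d < N) y d;
  hom_direct : forall (N : nat) (y : nat -> M), (forall d, hom d (y d)) ->
    \sum_(d < N) y d = 0 -> forall d, (d < N)%N -> y d = 0 }.

Definition homog_basis (M : lmodType E) (hom : nat -> M -> Prop)
    (B : finType) (b : B -> M) (deg : B -> nat) : Prop :=
  (forall k, hom (deg k) (b k)) /\
  (forall x, exists! c : {ffun B -> E}, x = \sum_k c k *: b k).

(* the submodule J M *)
Definition ideal_mul (J : E -> Prop) (M : lmodType E) (x : M) : Prop :=
  exists (N : nat) (c : 'I_N -> E) (y : 'I_N -> M),
    (forall k, J (c k)) /\ x = \sum_k c k *: y k.

(* Here d i is the differential F_(i+1) -> F_i, and the augmentation F_0 -> E/J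
   is the composite of eps with the projection E -> E/J. *)
Record graded_free_resolution (F : nat -> lmodType E)
    (hom : forall i, nat -> F i -> Prop) (d : forall i, {linear F i.+1 -> F i})
    (eps : {linear F 0 -> E^o}) (J : E -> Prop) : Prop := GradedFreeResolution {
  res_grading : forall i, is_grading (@hom i);
  res_free : forall i, exists (B : finType) (b : B -> F i) (deg : B -> nat),
    homog_basis (@hom i) b deg;
  res_homog : forall i k x, hom i.+1 k x -> hom i k (d i x);
  res_exact : forall i x, d i x = 0 <-> exists y, x = d i.+1 y;
  res_eps_homog : forall k x, hom 0 k x -> ehomog k (eps x : E);
  res_exact0 : forall x, J (eps x) <-> exists y, x = d 0 y;
  res_surj : forall z : E, exists x, J (z - eps x) }.

Definition minimal_complex (F : nat -> lmodType E)
    (d : forall i, {linear F i.+1 -> F i}) : Prop :=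
  forall i x, ideal_mul (evar_gen [set: 'I_n]) (d i x).

End GradedModules.

Section Cartan.
Variables (K : fieldType) (n : nat).
Local Notation E := (exterior K n).

Definition mnm_supp (a : 'X_{1..n}) : {set 'I_n} := [set k | a k != 0%N].

Definition cartan_idx (S : {set 'I_n}) (i : nat) : Type :=
  {a : 'X_{1..n < i.+1} | (mdeg a == i) && (mnm_supp a \subset S)}.

HB.instance Definition _ (S : {set 'I_n}) (i : nat) :=
  Finite.on (cartan_idx S i).

(* The Cartan complex of the sequence (v_k)_{k in S}, the exponents being
   regarded as elements of N^n supported in S. *)
Definition cartan (S : {set 'I_n}) (i : nat) : lmodType E :=
  {ffun cartan_idx S i -> E^o}.

(* x^(a), and 0 if a does not index a basis element *)
Definition dpow (S : {set 'I_n}) (i : nat) (a : 'X_{1..n}) : cartan S i :=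
  [ffun b => (bmnm (val b) == a)%:R].

Definition cartan_diff (v : 'I_n -> E) (S : {set 'I_n}) (i : nat)
    (c : cartan S i.+1) : cartan S i :=
  \sum_(a : cartan_idx S i.+1) (c : {ffun cartan_idx S i.+1 -> E^o}) a *:
    \sum_(k in S | bmnm (val a) k != 0%N)
      v k *: dpow S i (bmnm (val a) - U_(k))%MM.

Lemma cartan_diff_linear v S i : linear (@cartan_diff v S i).
Proof.
move=> c x y; rewrite /cartan_diff scaler_sumr -big_split; apply: eq_bigr => a _.
by rewrite !ffunE scalerDl scalerA.
Qed.

HB.instance Definition _ v S i :=
  GRing.isLinear.Build E (cartan S i.+1) (cartan S i) *:%R (@cartan_diff v S i)
    (@cartan_diff_linear v S i).

(* graded so that x^(a) has degree |a| + s *)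
Definition cartan_homog (s : nat) (S : {set 'I_n}) (i d : nat)
    (c : cartan S i) : Prop :=
  forall (a : cartan_idx S i) A,
    ecoef ((c : {ffun cartan_idx S i -> E^o}) a) A != 0 ->
    (#|A| + (mdeg (bmnm (val a)) + s))%N = d.

End Cartan.

Section MappingCone.
Variables (K : fieldType) (n : nat).
Local Notation E := (exterior K n).
Variables (C F : nat -> lmodType E).

Definition cone (i : nat) : lmodType E :=
  if i is i'.+1 then (C i' * F i)%type else F 0%N.

Variables (dC : forall i, {linear C i.+1 -> C i}).
Variables (dF : forall i, {linear F i.+1 -> F i}).
Variables (psi : forall i, {linear C i -> F i}).

Definition cone_diff (i : nat) : cone i.+1 -> cone i :=
  match i return cone i.+1 -> cone i with
  | 0 => fun x => psi 0 x.1 + dF 0 x.2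
  | i'.+1 => fun x => (- dC i' x.1, psi i'.+1 x.1 + dF i'.+1 x.2)
  end.

Lemma cone_diff_linear i : linear (@cone_diff i).
Proof.
case: i => [|i] c [x1 x2] [y1 y2] /=; rewrite !linearP.
  by rewrite scalerDr addrACA.
by apply: (congr2 pair) => //=; rewrite scalerDr addrACA.
Qed.

HB.instance Definition _ i :=
  GRing.isLinear.Build E (cone i.+1) (cone i) *:%R (@cone_diff i)
    (@cone_diff_linear i).

Definition cone_homog (homC : forall i, nat -> C i -> Prop)
    (homF : forall i, nat -> F i -> Prop) (i d : nat) : cone i -> Prop :=
  match i return cone i -> Prop with
  | 0 => fun x => homF 0%N d x
  | i'.+1 => fun x => homC i' d x.1 /\ homF i'.+1 d x.2
  end.

End MappingCone.

Section IteratedMappingCone.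
Variables (K : fieldType) (n : nat).
Local Notation E := (exterior K n).

Definition concentrated (i : nat) : lmodType E :=
  if i is 0 then E^o else 'rV[E]_0.

Variable us : seq {set 'I_n}.

Definition cartan_at (j i : nat) : lmodType E :=
  cartan K (lqset K us (nth set0 us j)) i.

Definition cartan_at_diff (j i : nat) : {linear cartan_at j i.+1 -> cartan_at j i} :=
  @cartan_diff K n (@evar K n) (lqset K us (nth set0 us j)) i.

Definition cartan_at_homog (j i d : nat) : cartan_at j i -> Prop :=
  @cartan_homog K n #|nth set0 us j| (lqset K us (nth set0 us j)) i d.

(* The free modules F^(j)_i do not depend on the comparison maps. *)
Fixpoint itcone (j : nat) : nat -> lmodType E :=
  if j is j'.+1 then cone (cartan_at j') (itcone j') else concentrated.

Fixpoint itcone_homog (j : nat) : forall i, nat -> itcone j i -> Prop :=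
  match j return forall i, nat -> itcone j i -> Prop with
  | 0 => fun i => match i return nat -> concentrated i -> Prop with
                  | 0 => fun d x => ehomog d (x : E)
                  | _.+1 => fun _ _ => True
                  end
  | j'.+1 => @cone_homog K n _ _ (@cartan_at_homog j') (@itcone_homog j')
  end.

(* the identification F^(j)_0 = E *)
Fixpoint itcone_aug (j : nat) : {linear itcone j 0 -> E^o} :=
  match j return {linear itcone j 0 -> E^o} with
  | 0 => idfun
  | j'.+1 => itcone_aug j'
  end.

(* psi j i is the component C^(j)_i -> F^(j)_i of the comparison map *)
Variable psi : forall j i, {linear cartan_at j i -> itcone j i}.

Fixpoint itcone_diff (j : nat) : forall i, {linear itcone j i.+1 -> itcone j i} :=
  match j return forall i, {linear itcone j i.+1 -> itcone j i} with
  | 0 => fun i => \0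
  | j'.+1 => fun i =>
      cone_diff (cartan_at_diff j') (itcone_diff j') (psi j') (i:=i)
  end.

(* psi j is a homogeneous chain map lifting E/L_j -> E/I_j, x |-> x u_(j+1) *)
Record comparison (j : nat) : Prop := Comparison {
  comparison_homog : forall i d c,
    @cartan_at_homog j i d c -> @itcone_homog j i d (psi j i c);
  comparison_chain : forall i c,
    psi j i (cartan_at_diff j i c) = itcone_diff j i (psi j i.+1 c);
  comparison_lift : forall c : E,
    @partial_ideal K n us j
      (itcone_aug j (psi j 0%N (c *: dpow K (lqset K us (nth set0 us j)) 0 0%MM))
       - c * emono K (nth set0 us j)) }.

(* f(a; u), as an element of F^(j)_i; it is 0 if u is not among u_1, ..., u_j
   or if x^(a) is not a basis element in homological degree i - 1 *)
Fixpoint itcone_basis (j i : nat) (a : 'X_{1..n}) (u : {set 'I_n}) : itcone j i :=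
  match j return itcone j i with
  | 0 => 0
  | j'.+1 =>
    match i return itcone j'.+1 i with
    | 0 => 0
    | i'.+1 => if nth set0 us j' == u
               then (dpow K (lqset K us (nth set0 us j')) i' a, 0)
               else (0, itcone_basis j' i'.+1 a u)
    end
  end.

Definition basis_idx (i : nat) : Type :=
  {p : 'X_{1..n < i} * {set 'I_n} |
    [&& p.2 \in us, mnm_supp (bmnm p.1) \subset lqset K us p.2
      & mdeg (bmnm p.1) == i.-1]}.

HB.instance Definition _ (i : nat) := Finite.on (basis_idx i).

End IteratedMappingCone.

(* Main.v *)
Require Import Defs.
From HB Require Import structures.
From mathcomp Require Import all_boot all_order all_algebra.
From mathcomp Require Import boolp.
From mathcomp Require Import mpoly.

Set Implicit Arguments.
Unset Strict Implicit.
Unset Printing Implicit Defensive.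

Import GRing.Theory.
Local Open Scope ring_scope.

(** The Cartan complex of a set [S] of variables is acyclic because right
    contraction by [e_k], [k] in [S], combined with raising the exponent of
    [x_k], gives a homotopy between [0] and the projection onto the span of the
    [e_A x^(a)] such that [k] lies in [A] or in the support of [a]; applying
    these homotopies for all [k] in [S] in turn makes every cycle a boundary.
    The colon ideals being generated by variables, each mapping cone is then a
    resolution.  It is minimal for degree reasons: the comparison map sends
    [f(a; u_(j+1))], of degree [i + deg u_(j+1)] with [i = |a|], into a free
    module generated in degrees [i - 1 + deg u_l], [l <= j] (degree [0] if
    [i = 0]), and [deg u_l <= deg u_(j+1)]. *)

(** * Coefficients, monomial ideals and right contraction in the exterior algebra *)

Section Exterior.
Variables (K : fieldType) (n : nat).
Local Notation E := (exterior K n).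
Implicit Types (A B C u : {set 'I_n}) (x y z : E).

Lemma ecoef0 A : ecoef (0 : E) A = 0.
Proof. by rewrite /ecoef ffunE. Qed.

Lemma ecoefN x A : ecoef (- x) A = - ecoef x A.
Proof. by rewrite -scaleN1r ecoefZ mulN1r. Qed.

Lemma ecoef_mul x y C :
  ecoef (x * y) C = \sum_A \sum_B ecoef x A * ecoef y B * ecoef (mono_mul K A B) C.
Proof.
rewrite [x * y]/(emul x y) /emul ecoef_sum; apply: eq_bigr => A _.
by rewrite ecoef_sum; apply: eq_bigr => B _; rewrite ecoefZ.
Qed.

Lemma ecoef_mul_neq0 x y C : ecoef (x * y) C != 0 ->
  exists A B, [/\ [disjoint A & B], C = A :|: B, ecoef x A != 0 & ecoef y B != 0].
Proof.
move=> nz; apply: contrapT => no; move/eqP: nz; apply.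
rewrite ecoef_mul big1 // => A _; rewrite big1 // => B _; rewrite /mono_mul.
case: ifP => [dAB|_]; last by rewrite ecoef0 mulr0.
rewrite ecoefZ ecoef_mono; case: eqP => [eC|_]; last by rewrite !mulr0.
case: (eqVneq (ecoef x A) 0) => [->|nx]; first by rewrite !mul0r.
case: (eqVneq (ecoef y B) 0) => [->|ny]; first by rewrite mulr0 mul0r.
by case: no; exists A, B.
Qed.

Lemma emono_divr A u : u \subset A -> exists w : E, emono K A = w * emono K u.
Proof.
(* The sign cancels the one that appears when [A :\: u] and [u] are merged. *)
move=> suA; exists ((-1) ^+ ninv (A :\: u) u *: emono K (A :\: u)).
rewrite -scalerAl mono_mulE /mono_mul ifT; last first.
  by rewrite -setI_eq0 setIDAC setDIl setDv setI0.
rewrite scalerA -exprD addnn -mul2n exprM sqrrN !expr1n scale1r.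
by congr emono; rewrite setDE setUIl [~: u :|: u]setUC setUCr setIT (setUidPl suA).
Qed.

Lemma is_ideal_gen (G : E -> Prop) : is_ideal (ideal_gen G).
Proof.
split=> [J [] //|x y gx gy J iJ GJ|a x gx J iJ GJ|a x gx J iJ GJ].
- by apply: (idealD iJ); [apply: gx|apply: gy].
- by apply: (idealMl iJ); apply: gx.
- by apply: (Defs.idealMr iJ); apply: gx.
Qed.

Lemma ideal_sum (J : E -> Prop) (X : Type) (r : seq X) (P : pred X) (F : X -> E) :
  is_ideal J -> (forall i, P i -> J (F i)) -> J (\sum_(i <- r | P i) F i).
Proof.
by move=> iJ JF; elim/big_ind: _ => //; [apply: ideal0|move=> ? ?; apply: idealD].
Qed.

(** The support condition on the right defines an ideal containing the generators, which gives one
    direction. Conversely, each monomial of [x] is a multiple of some generator, and ideals are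
    closed under sums. Ideal membership thus becomes a test on single coefficients. *)
Lemma mono_genP (M : {set {set 'I_n}}) x :
  mono_gen M x <-> forall A, ecoef x A != 0 -> exists2 u, u \in M & u \subset A.
Proof.
split=> [|H].
  move/(_ (fun x => forall A, ecoef x A != 0 -> exists2 u, u \in M & u \subset A)).
  apply; first split.
  - by move=> A; rewrite ecoef0 eqxx.
  - move=> y z Hy Hz A; rewrite ecoefD => nz.
    case: (eqVneq (ecoef y A) 0) => [y0|]; last exact: Hy.
    by apply: Hz; rewrite y0 add0r in nz.
  - move=> a y Hy C /ecoef_mul_neq0[A [B [_ -> _ /Hy[u Mu suB]]]].
    by exists u => //; apply: subset_trans suB _; apply: subsetUr.
  - move=> a y Hy C /ecoef_mul_neq0[A [B [_ -> /Hy[u Mu suA] _]]].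
    by exists u => //; apply: subset_trans suA _; apply: subsetUl.
  move=> _ [u Mu ->] A; rewrite ecoef_mono.
  case: (A =P u) => [->|_]; [by exists u|by rewrite eqxx].
rewrite (mono_decomp x); apply: ideal_sum => [|A _]; first exact: is_ideal_gen.
have [->|/H[u Mu /emono_divr[w ->]]] := eqVneq (ecoef x A) 0.
  by rewrite scale0r; apply: (ideal0 (is_ideal_gen _)).
rewrite scalerAl; apply: (Defs.idealMl (is_ideal_gen _)).
by move=> J _; apply; exists u.
Qed.

Lemma evar_genP (S : {set 'I_n}) x :
  evar_gen S x <-> forall A, ecoef x A != 0 -> exists2 k, k \in S & k \in A.
Proof.
have -> : evar_gen S x <-> mono_gen [set [set k] | k in S] x.
  split=> H J iJ GJ; apply: H => // g.
    by move=> [k Sk ->]; apply: GJ; exists [set k] => //; apply: imset_f.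
  by move=> [_ /imsetP[k Sk ->] ->]; apply: GJ; exists k.
rewrite mono_genP; split=> H A /H.
  by move=> [_ /imsetP[k Sk ->]]; rewrite sub1set; exists k.
by move=> [k Sk kA]; exists [set k]; rewrite ?sub1set // imset_f.
Qed.

(** Reduces minimality to the absence of constant terms, which can be checked by degrees. *)
Lemma evar_genT x : evar_gen [set: 'I_n] x <-> ecoef x set0 = 0.
Proof.
rewrite evar_genP; split=> [H|x0 A].
  by apply/eqP; apply/negP => /negP/H[k _]; rewrite inE.
case: (set_0Vmem A) => [->|[k kA] _]; first by rewrite x0 eqxx.
by exists k.
Qed.

Lemma evar_in_gen (S : {set 'I_n}) k : evar_gen S (evar K k) <-> k \in S.
Proof.
split=> [/evar_genP/(_ [set k])|Sk J _]; last by apply; exists k.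
rewrite ecoef_mono eqxx oner_eq0 => /(_ isT)[l Sl].
by rewrite inE => /eqP <-.
Qed.

(** Each monomial of [x] is divisible by some generator: it contributes to [w] if that generator is
    [u], and to [y] otherwise. Left multiples of [u] suffice because monomials can be factored with
    [u] on the right. *)
Lemma mono_gen_rcons (us : seq {set 'I_n}) u x :
  mono_gen [set v in rcons us u] x <->
  exists y w : E, mono_gen [set v in us] y /\ x = y + w * emono K u.
Proof.
have in_rcons v : v \in [set v in rcons us u] = (v == u) || (v \in us).
  by rewrite inE mem_rcons inE.
split=> [/mono_genP H|[y [w [/mono_genP H ->]]]]; last first.
  apply/mono_genP => A; rewrite ecoefD; have [y0|/H[v vus svA] _] := eqVneq (ecoef y A) 0.
    rewrite y0 add0r => /ecoef_mul_neq0[B [C [_ -> _]]]; rewrite ecoef_mono.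
    case: (C =P u) => [-> _|_]; last by rewrite eqxx.
    by exists u; rewrite ?subsetUr // in_rcons eqxx.
  by exists v => //; rewrite in_rcons; move: vus; rewrite inE orbC => ->.
rewrite (mono_decomp x); elim/big_ind: _ => [|_ _ [y [w [Iy ->]]] [y' [w' [Iy' ->]]]|A _].
- exists 0, 0; split; last by rewrite mul0r addr0.
  exact: ideal0 (is_ideal_gen _).
- exists (y + y'), (w + w'); split; last by rewrite mulrDl addrACA.
  exact: idealD (is_ideal_gen _) _ _ Iy Iy'.
have [->|/H[v]] := eqVneq (ecoef x A) 0.
  exists 0, 0; split; last by rewrite scale0r mul0r addr0.
  exact: ideal0 (is_ideal_gen _).
rewrite in_rcons => /orP[/eqP->|vus] svA.
  have [w ->] := emono_divr svA; exists 0, (ecoef x A *: w).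
  split; last by rewrite add0r scalerAl.
  exact: ideal0 (is_ideal_gen _).
exists (ecoef x A *: emono K A), 0; split; last by rewrite mul0r addr0.
apply/mono_genP => B; rewrite ecoefZ ecoef_mono.
by case: (B =P A) => [-> _|_]; [exists v; rewrite ?inE|rewrite mulr0 eqxx].
Qed.

Lemma ninv_setU1 A B k : k \notin A -> ninv (k |: A) B = (ninv [set k] B + ninv A B)%N.
Proof. by move=> nkA; rewrite ninvUl // disjoints1. Qed.

Lemma ecoef_mul_evar x k B :
  ecoef (x * evar K k) B =
    if k \in B then (-1) ^+ ninv B [set k] * ecoef x (B :\ k) else 0.
Proof.
(* Since [k] forms no inversion with itself, the sign can be counted over [B] instead of
   [B :\ k]. *)
have kk : ninv [set k] [set k] = 0%N by rewrite /ninv !big_set1 ltnn.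
rewrite {1}(mono_decomp x) mulr_suml ecoef_sum.
transitivity (\sum_A ecoef x A *
    (if (k \notin A) && (B == k |: A) then (-1) ^+ ninv B [set k] else 0)).
  apply: eq_bigr => A _; rewrite -scalerAl ecoefZ mono_mulE /mono_mul.
  rewrite disjoint_sym disjoints1; case: ifP => nkA /=; last by rewrite ecoef0.
  rewrite ecoefZ ecoef_mono setUC; case: eqP => [->|]; last by rewrite mulr0.
  by rewrite mulr1 ninv_setU1 // kk.
case: ifP => kB; last first.
  rewrite big1 // => A _; case: andP => [[_ /eqP eB]|_]; last by rewrite mulr0.
  by rewrite eB setU11 in kB.
rewrite (bigD1 (B :\ k)) //= setD11 setD1K // eqxx big1 => [|A neA].
  by rewrite addr0 mulrC.
case: andP => [[nkA /eqP eB]|_]; last by rewrite mulr0.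
by rewrite eB setU1K ?eqxx // in neA.
Qed.

(* right contraction by e_k: y + z e_k goes to z when y, z do not involve e_k *)
Definition contr (k : 'I_n) x : E :=
  [ffun B : {set 'I_n} => (if k \in B then 0
            else (-1) ^+ ninv B [set k] * ecoef x (k |: B)) : K^o].

Lemma ecoef_contr k x B :
  ecoef (contr k x) B =
    if k \in B then 0 else (-1) ^+ ninv B [set k] * ecoef x (k |: B).
Proof. by rewrite /ecoef ffunE. Qed.

Lemma contrD k x y : contr k (x + y) = contr k x + contr k y.
Proof.
apply: extP => B; rewrite ecoefD !ecoef_contr.
by case: ifP => _; rewrite ?addr0 // ecoefD mulrDr.
Qed.

Lemma contr0 k : contr k 0 = 0.
Proof. by apply: extP => B; rewrite ecoef_contr !ecoef0 mulr0 if_same. Qed.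

Lemma contr_sum k (X : Type) (r : seq X) (P : pred X) (F : X -> E) :
  contr k (\sum_(i <- r | P i) F i) = \sum_(i <- r | P i) contr k (F i).
Proof. by apply: (big_morph (contr k)); [apply: contrD|apply: contr0]. Qed.

(** The two signs are equal and cancel, so contraction followed by multiplication by [evar K k] is
    the projection onto the monomials involving it. *)
Lemma ecoef_contr_mul k x B :
  ecoef (contr k x * evar K k) B = if k \in B then ecoef x B else 0.
Proof.
rewrite ecoef_mul_evar ecoef_contr setD11; case: ifP => // kB.
rewrite setD1K // -{1}(setD1K kB) ninv_setU1 ?setD11 //.
rewrite {1}/ninv !big_set1 ltnn add0n mulrA -exprD addnn -mul2n exprM sqrrN.
by rewrite !expr1n mul1r.
Qed.

(** A Clifford relation. For [l = k] the two terms are the complementary projections onto the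
    monomials without and with [evar K k]; for [l != k] they agree up to opposite signs. *)
Lemma contr_mul_evar k l x :
  contr k (x * evar K l) + contr k x * evar K l = if l == k then x else 0.
Proof.
apply: extP => B; rewrite ecoefD ecoef_contr.
have [->|nlk] := eqVneq l k.
  rewrite ecoef_contr_mul ecoef_mul_evar setU11; case: ifP => kB.
    by rewrite add0r.
  rewrite addr0 setU1K ?kB // ninv_setU1 ?kB //.
  rewrite {2}/ninv !big_set1 ltnn add0n mulrA -exprD addnn -mul2n exprM sqrrN.
  by rewrite !expr1n mul1r.
rewrite !ecoef_mul_evar ecoef_contr ecoef0 !inE (eq_sym k) (negbTE nlk) /=.
case: (boolP (k \in B)) => kB; first by rewrite !(add0r, mulr0, if_same).
case: (boolP (l \in B)) => lB; last by rewrite mulr0 addr0.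
have -> : (k |: B) :\ l = k |: B :\ l.
  by apply/setP => m; rewrite !inE; case: (eqVneq m k) => [->|]; rewrite ?(eq_sym k) ?nlk.
rewrite -{1}(setD1K lB) !ninv_setU1 ?setD11 // !mulrA -mulrDl.
(* Exactly one of the orders [k, l] and [l, k] is an inversion; this odd total makes the two signs
   opposite. *)
have nkl : (ninv [set k] [set l] + ninv [set l] [set k])%N = 1%N.
  rewrite /ninv !big_set1.
  by case: ltngtP nlk => // /val_inj ->; rewrite eqxx.
rewrite -!exprD addnACA addnC [X in (_ + X)%N]addnC nkl addn1 exprS mulN1r.
by rewrite [in X in _ + X]addnC addNr mul0r.
Qed.
End Exterior.

(** Off-diagonal terms cancel in pairs, the pairs being ordered by [enum_rank]. The vanishing on the
    diagonal is a separate hypothesis, as antisymmetry does not imply it in the presence of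
    2-torsion. *)
Lemma sum_antisym (V : zmodType) (X : finType) (P : pred X) (f : X -> X -> V) :
    (forall k, f k k = 0) -> (forall k l, f k l = - f l k) ->
  \sum_(k | P k) \sum_(l | P l) f k l = 0.
Proof.
move=> f0 fN; pose r (k l : X) := (enum_rank k < enum_rank l)%N.
have split_sum k : \sum_(l | P l) f k l =
    \sum_(l | P l && r k l) f k l + \sum_(l | P l && r l k) f k l.
  rewrite (bigID (r k)) /=; congr (_ + _).
  rewrite (bigID (r^~ k)) /= [X in _ + X]big1 ?addr0 => [|l].
    by apply: eq_bigl => l; rewrite -andbA /r ltnNge; case: ltngtP; rewrite ?andbF.
  rewrite /r -!leqNgt => /andP[/andP[_ le1] le2].
  suff -> : l = k by apply: f0.
  by apply/enum_rank_inj/val_inj/anti_leq; rewrite le1.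
rewrite (eq_bigr _ (fun k _ => split_sum k)) big_split /=.
rewrite (exchange_big_dep P) /=; last by move=> k l _ /andP[].
rewrite -[RHS](subrr (\sum_(k | P k) \sum_(l | P l && r l k) f k l)) addrC.
congr (_ + _); rewrite -sumrN; apply: eq_bigr => k Pk; rewrite -sumrN.
by apply: eq_big => [l|l _]; rewrite ?Pk.
Qed.

(** * The Cartan complex: coefficients, contracting homotopies and exactness *)

Section CartanCoef.
Variables (K : fieldType) (n : nat) (S : {set 'I_n}).
Local Notation E := (exterior K n).
Local Notation cartan := (cartan K S).
Implicit Types (i : nat) (a m : 'X_{1..n}) (k l : 'I_n).

Definition ccoef i (c : cartan i) (b : cartan_idx S i) : E :=
  (c : {ffun cartan_idx S i -> E^o}) b.

Lemma ccoefP i (c c' : cartan i) : ccoef c =1 ccoef c' -> c = c'.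
Proof. by move=> h; apply/ffunP. Qed.

Lemma ccoefD i (c c' : cartan i) b : ccoef (c + c') b = ccoef c b + ccoef c' b.
Proof. by rewrite /ccoef ffunE. Qed.

Lemma ccoefZ i x (c : cartan i) b : ccoef (x *: c) b = x * ccoef c b.
Proof. by rewrite /ccoef ffunE. Qed.

Lemma ccoef0 i b : ccoef (0 : cartan i) b = 0.
Proof. by rewrite /ccoef ffunE. Qed.

Lemma ccoef_sum i (X : Type) (r : seq X) (P : pred X) (F : X -> cartan i) b :
  ccoef (\sum_(x <- r | P x) F x) b = \sum_(x <- r | P x) ccoef (F x) b.
Proof. by rewrite /ccoef sum_ffunE. Qed.

Lemma ccoef_dpow i a b : ccoef (dpow K S i a) b = (bmnm (val b) == a)%:R.
Proof. by rewrite /ccoef ffunE. Qed.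

Lemma cartan_decomp i (c : cartan i) :
  c = \sum_b ccoef c b *: dpow K S i (bmnm (val b)).
Proof.
apply: ccoefP => b; rewrite ccoef_sum (bigD1 b) //= ccoefZ ccoef_dpow eqxx mulr1.
rewrite big1 ?addr0 // => b' neb; rewrite ccoefZ ccoef_dpow.
by rewrite (inj_eq val_inj) (inj_eq val_inj) eq_sym (negbTE neb) mulr0.
Qed.

Lemma cartan_idxP i a :
  mdeg a = i -> mnm_supp a \subset S -> exists b : cartan_idx S i, bmnm (val b) = a.
Proof.
move=> da sa; have lt_a : (mdeg a < i.+1)%N by rewrite da.
have Pa : (mdeg (BMultinom lt_a) == i) && (mnm_supp (BMultinom lt_a) \subset S).
  by rewrite /= da eqxx.
by exists (exist _ (BMultinom lt_a) Pa).
Qed.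

Lemma mdeg_idx i (b : cartan_idx S i) : mdeg (bmnm (val b)) = i.
Proof. by case: b => b /= /andP[/eqP]. Qed.

Lemma supp_idx i (b : cartan_idx S i) : mnm_supp (bmnm (val b)) \subset S.
Proof. by case: b => b /= /andP[]. Qed.

(* extension by zero of the coefficient function to all exponents *)
Definition cext i (c : cartan i) a : E :=
  \sum_(b : cartan_idx S i | bmnm (val b) == a) ccoef c b.

Lemma cext_idx i (c : cartan i) b : cext c (bmnm (val b)) = ccoef c b.
Proof. by rewrite /cext (big_pred1 b). Qed.

Lemma cext_out i (c : cartan i) a :
  ~~ ((mdeg a == i) && (mnm_supp a \subset S)) -> cext c a = 0.
Proof.
move=> out; rewrite /cext big_pred0 // => b.
by apply: contraNF out => /eqP <-; rewrite mdeg_idx eqxx supp_idx.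
Qed.

Lemma cext_linear i a x (c c' : cartan i) :
  cext (x *: c + c') a = x * cext c a + cext c' a.
Proof.
rewrite /cext mulr_sumr -big_split; apply: eq_bigr => b _.
by rewrite ccoefD ccoefZ.
Qed.

Lemma cext_dpow i a a' : mdeg a' = i -> mnm_supp a' \subset S ->
  cext (dpow K S i a') a = (a' == a)%:R.
Proof.
move=> da' sa'.
case: (boolP ((mdeg a == i) && (mnm_supp a \subset S))) =>
    [/andP[/eqP da sa]|out].
  by have [b <-] := cartan_idxP da sa; rewrite cext_idx ccoef_dpow eq_sym.
rewrite cext_out //; case: eqP => // ea.
by rewrite -ea da' eqxx sa' in out.
Qed.

Lemma mnm_suppDU a k :
  (mnm_supp (a + U_(k))%MM \subset S) = (mnm_supp a \subset S) && (k \in S).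
Proof.
apply/subsetP/andP => [H|[/subsetP H kS] l].
  split; last by apply: H; rewrite inE mnmDE mnm1E eqxx addn1.
  apply/subsetP => l; rewrite inE => al; apply: H.
  by rewrite inE mnmDE addn_eq0 negb_and al.
rewrite inE mnmDE mnm1E addn_eq0 negb_and => /orP[al|].
  by apply: H; rewrite inE.
by case: (k =P l) => // <-.
Qed.

(** The differential read on coefficients: the one at [a] collects those one step above [a]. With
    coefficients extended to all exponents, no membership proofs for the indices are carried
    along. *)
Lemma cext_diff v i (c : cartan i.+1) a :
  cext (cartan_diff v c) a = \sum_(k in S) cext c (a + U_(k))%MM * v k.
Proof.
case: (boolP ((mdeg a == i) && (mnm_supp a \subset S))) =>
    [/andP[/eqP da sa]|out]; last first.
  rewrite cext_out // big1 // => k kS; rewrite cext_out ?mul0r //.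
  by rewrite mnm_suppDU mdegD mdeg1 addn1 eqSS kS andbT.
have [b <-] := cartan_idxP da sa; rewrite cext_idx /cartan_diff ccoef_sum.
transitivity (\sum_(a0 : cartan_idx S i.+1) \sum_(k in S)
   if bmnm (val a0) == (bmnm (val b) + U_(k))%MM then ccoef c a0 * v k else 0).
  apply: eq_bigr => a0 _; rewrite ccoefZ ccoef_sum mulr_sumr big_mkcondr /=.
  apply: eq_bigr => k _; rewrite ccoefZ ccoef_dpow.
  case: ifP => [nz|z].
    (* Truncated subtraction of [U_(k)] is inverted by addition because the exponent at [k] is
       nonzero. *)
    have -> : (bmnm (val b) == bmnm (val a0) - U_(k))%MM =
        (bmnm (val a0) == bmnm (val b) + U_(k))%MM.
      by apply/eqP/eqP => [->|->]; rewrite ?addmK // submK // lep1mP nz.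
    by case: ifP => _; rewrite ?mulr1 ?mulr0.
  case: eqP => // e; move: z; rewrite e mnmDE mnm1E eqxx addn1 //.
rewrite exchange_big; apply: eq_bigr => k _ /=.
by rewrite /cext mulr_suml [RHS]big_mkcond.
Qed.

Lemma cextP i (c c' : cartan i) : cext c =1 cext c' -> c = c'.
Proof. by move=> h; apply: ccoefP => b; rewrite -!cext_idx. Qed.

Lemma cext0 i a : cext (0 : cartan i) a = 0.
Proof. by rewrite /cext big1 // => b _; rewrite ccoef0. Qed.

Lemma cextB i (c c' : cartan i) a : cext (c - c') a = cext c a - cext c' a.
Proof. by rewrite addrC -scaleN1r cext_linear mulN1r addrC. Qed.

Local Notation d := (@cartan_diff K n (@evar K n) S).

Lemma cext_diff_diff i (c : cartan i.+1) a :
  \sum_(k in S) cext (d c) (a + U_(k))%MM * evar K k = 0.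
Proof.
under eq_bigr => k _ do rewrite cext_diff mulr_suml.
apply: sum_antisym => [k|k l].
  by rewrite -mulrA evar_sqr mulr0.
by rewrite -!mulrA [evar K l * _]evar_anticomm mulrN -!addmA [(U_(l) + _)%MM]addmC.
Qed.

Lemma cartan_diffK i (c : cartan i.+2) : d (d c) = 0.
Proof. by apply: cextP => a; rewrite cext_diff cext_diff_diff cext0. Qed.

(** On divided powers, raising an exponent brings in no numerical factor, so this homotopy works in
    every characteristic. *)
Definition chomot k i (c : cartan i) : cartan i.+1 :=
  [ffun b : cartan_idx S i.+1 =>
     if bmnm (val b) k != 0%N then contr k (cext c (bmnm (val b) - U_(k))%MM) else 0].

Lemma cext_chomot k i (c : cartan i) a : k \in S ->
  cext (chomot k c) a = if a k != 0%N then contr k (cext c (a - U_(k))%MM) else 0.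
Proof.
move=> kS.
case: (boolP ((mdeg a == i.+1) && (mnm_supp a \subset S))) =>
    [/andP[/eqP da sa]|out].
  by have [b <-] := cartan_idxP da sa; rewrite cext_idx /ccoef ffunE.
rewrite cext_out //; case: ifP => // ak; rewrite cext_out ?contr0 //.
apply: contra out => /andP[/eqP da sa].
have -> : a = (a - U_(k) + U_(k))%MM by rewrite submK // lep1mP.
by rewrite mnm_suppDU sa kS mdegD da mdeg1 addn1 eqxx.
Qed.

(** If [x_k] occurs in [a], the relation [contr_mul_evar] applied to every [l] leaves the
    coefficient minus a correction; the inner sum is the coefficient of the differential of [c] at
    [a - U_(k)], spelled out so that it also makes sense for [i = 0]. If [x_k] does not occur, only
    [l = k] survives and gives the projection onto the monomials involving [evar K k]. *)
Lemma cext_diff_chomot k i (c : cartan i) a : k \in S ->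
  cext (d (chomot k c)) a =
    if a k != 0%N
    then cext c a - contr k (\sum_(l in S) cext c (a - U_(k) + U_(l))%MM * evar K l)
    else contr k (cext c a) * evar K k.
Proof.
move=> kS; rewrite cext_diff.
case: ifP => ak; last first.
  rewrite (bigD1 k) //= cext_chomot // mnmDE mnm1E eqxx addn1 /= addmK.
  rewrite big1 ?addr0 // => l /andP[_ lk].
  rewrite cext_chomot // mnmDE mnm1E (negbTE lk) addn0 ak mul0r //.
apply/eqP; rewrite eq_sym subr_eq contr_sum -big_split /=; apply/eqP.
rewrite (bigD1 k) //= big1 => [|l /andP[_ lk]].
  rewrite cext_chomot // mnmDE mnm1E eqxx addn1 /= addmK addr0 addrC.
  by rewrite submK ?lep1mP // contr_mul_evar eqxx.
rewrite cext_chomot // mnmDE mnm1E (negbTE lk) addn0 ak.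
have -> : (a + U_(l) - U_(k) = a - U_(k) + U_(l))%MM.
  have le_ka : (U_(k) <= a)%MM by rewrite lep1mP.
  by rewrite -{1}(submK le_ka) -addmA [(U_(k) + _)%MM]addmC addmA addmK.
by rewrite addrC contr_mul_evar (negbTE lk).
Qed.

(* The second hypothesis says that c is a cycle, and is automatic for i = 0. *)
Lemma cartan_reduce (s : seq 'I_n) i (c : cartan i) : {subset s <= S} ->
    (forall a k, a k != 0%N ->
       \sum_(l in S) cext c (a - U_(k) + U_(l))%MM * evar K l = 0) ->
  exists y, forall a A, ecoef (cext (c - d y) a) A != 0 ->
    ecoef (cext c a) A != 0 /\ {in s, forall k, a k = 0%N /\ k \notin A}.
Proof.
move=> + cyc; elim: s => [|k s IHs] ks.
  by exists 0 => a A; rewrite linear0 subr0.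
have [|y Hy] := IHs; first by move=> l ls; apply: ks; rewrite inE ls orbT.
have kS : k \in S by apply: ks; rewrite inE eqxx.
(* The homotopy for [k] is applied to the remainder, which is still a cycle. It only deletes terms,
   so what was achieved for the earlier variables persists. *)
exists (y + chomot k (c - d y)) => a A; rewrite linearD opprD addrA cextB.
rewrite cext_diff_chomot //; case: (eqVneq (a k) 0%N) => [ak|ak] /=.
  rewrite ecoefD ecoefN ecoef_contr_mul; case: ifPn => [_|kA].
    by rewrite subrr eqxx.
  rewrite oppr0 addr0 => /Hy[nz Hs]; split=> // l; rewrite inE.
  by case/orP=> [/eqP->|/Hs].
rewrite [X in contr k X](_ : _ = 0) ?contr0 ?subr0 ?subrr ?ecoef0 ?eqxx //.
under eq_bigr => l _ do rewrite cextB mulrBl.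
by rewrite sumrB cyc // cext_diff_diff subrr.
Qed.

(** After reduction by all of [S], a surviving exponent vanishes on [S] and is supported in [S],
    hence is zero, against its degree [i.+1]. *)
Lemma cartan_exact i (c : cartan i.+1) : d c = 0 <-> exists y, c = d y.
Proof.
split=> [dc|[y ->]]; last exact: cartan_diffK.
have [|a k ak|y Hy] := @cartan_reduce (enum S) _ c.
- by move=> k; rewrite mem_enum.
- by rewrite -cext_diff dc cext0.
exists y; apply/eqP; rewrite -subr_eq0; apply/eqP/cextP => a; rewrite cext0.
apply: extP => A; rewrite ecoef0; apply/eqP; apply: contraT => nz.
have [_ Hs] := Hy _ _ nz.
case: (boolP ((mdeg a == i.+1) && (mnm_supp a \subset S))) =>
    [/andP[/eqP da /subsetP sa]|out].
  suff a0 : a = 0%MM by rewrite a0 mdeg0 in da.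
  apply/mnmP => k; rewrite mnm0E; apply/eqP; apply: contraT => ak.
  have kS : k \in S by apply: sa; rewrite inE.
  by have [|ak0 _] := Hs k; rewrite ?mem_enum // ak0 in ak *.
by rewrite cext_out ?ecoef0 ?eqxx in nz.
Qed.

(** Reduction by all of [S] leaves only monomials disjoint from [S], and these already occur in [c].
    If the coefficient of [c] lies in the ideal generated by the variables of [S], every monomial of
    it meets [S], so nothing survives. *)
Lemma cartan_exact0 (c : cartan 0) : evar_gen S (cext c 0%MM) <-> exists y, c = d y.
Proof.
split=> [/evar_genP gc|[y ->]]; last first.
  rewrite cext_diff; apply: ideal_sum => [|k kS]; first exact: is_ideal_gen.
  by apply: (Defs.idealMl (is_ideal_gen _)); apply/evar_in_gen.
have out0 a k : a k != 0%N -> cext c a = 0.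
  move=> ak; rewrite cext_out // mdeg_eq0; apply/negP => /andP[/eqP a0].
  by rewrite a0 mnm0E in ak.
have [|a k ak|y Hy] := @cartan_reduce (enum S) _ c.
- by move=> k; rewrite mem_enum.
- rewrite big1 // => l _; rewrite (@out0 _ l) ?mul0r //.
  by rewrite mnmDE mnm1E eqxx addn1.
exists y; apply/eqP; rewrite -subr_eq0; apply/eqP/cextP => a; rewrite cext0.
apply: extP => A; rewrite ecoef0; apply/eqP; apply: contraT => /Hy[nz Hs].
have a0 : a = 0%MM.
  apply/mnmP => k; rewrite mnm0E; apply/eqP; apply: contraT => /out0 ca.
  by rewrite ca ecoef0 eqxx in nz.
have [k kS kA] : exists2 k, k \in S & k \in A by apply: gc; rewrite -a0.
by have [|_] := Hs k; rewrite ?mem_enum ?kA.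
Qed.

Lemma cartan0_dpow (c : cartan 0) : c = cext c 0%MM *: dpow K S 0 0%MM.
Proof.
apply: ccoefP => b; rewrite ccoefZ ccoef_dpow.
have b0 : bmnm (val b) = 0%MM by apply/eqP; rewrite -mdeg_eq0 mdeg_idx.
by rewrite b0 eqxx mulr1 -cext_idx b0.
Qed.
End CartanCoef.

(** * The submodules [J M] *)

Section IdealMul.
Variables (K : fieldType) (n : nat) (J : exterior K n -> Prop).
Local Notation E := (exterior K n).
Hypothesis idealJ : is_ideal J.

Lemma ideal_mulS (M : lmodType E) (c : E) (x : M) : J c -> ideal_mul J (c *: x).
Proof. by exists 1%N, (fun _ => c), (fun _ => x); rewrite big_ord1. Qed.

Lemma ideal_mul0 (M : lmodType E) : ideal_mul J (0 : M).
Proof. by rewrite -(scale0r 0); apply: ideal_mulS; apply: ideal0. Qed.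

Lemma ideal_mulD (M : lmodType E) (x y : M) :
  ideal_mul J x -> ideal_mul J y -> ideal_mul J (x + y).
Proof.
move=> [N [c [u [Jc ->]]]] [N' [c' [u' [Jc' ->]]]].
exists (N + N')%N, (fun k => match split k with inl k => c k | inr k => c' k end),
  (fun k => match split k with inl k => u k | inr k => u' k end).
split; first by move=> k; case: (split k).
rewrite big_split_ord; congr (_ + _); apply: eq_bigr => k _.
  by rewrite (unsplitK (inl k)).
by rewrite (unsplitK (inr k)).
Qed.

Lemma ideal_mul_sum (M : lmodType E) (X : Type) (r : seq X) (P : pred X) (F : X -> M) :
  (forall k, P k -> ideal_mul J (F k)) -> ideal_mul J (\sum_(k <- r | P k) F k).
Proof.
by move=> JF; elim/big_ind: _ => //; [apply: ideal_mul0|move=> ? ?; apply: ideal_mulD].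
Qed.

Lemma ideal_mulZ (M : lmodType E) (c : E) (x : M) :
  ideal_mul J x -> ideal_mul J (c *: x).
Proof.
move=> [N [c' [u [Jc ->]]]]; exists N, (fun k => c * c' k), u; split=> [k|].
  by apply: idealMl.
by rewrite scaler_sumr; apply: eq_bigr => k _; rewrite scalerA.
Qed.

Lemma ideal_mul_pair (M M' : lmodType E) (x : M) (y : M') :
  ideal_mul J x -> ideal_mul J y -> ideal_mul J ((x, y) : (M * M')%type).
Proof.
have -> : (x, y) = (x, 0) + (0, y) :> (M * M')%type.
  by apply: (congr2 pair); rewrite ?addr0 ?add0r.
move=> [N [c [u [Jc ->]]]] [N' [c' [u' [Jc' ->]]]]; apply: ideal_mulD.
  exists N, c, (fun k => (u k, 0)); split=> //.
  rewrite [RHS]surjective_pairing; apply: (congr2 pair).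
    by rewrite (raddf_sum fst).
  by rewrite (raddf_sum snd) big1 // => k _ /=; rewrite scaler0.
exists N', c', (fun k => (0, u' k)); split=> //.
rewrite [RHS]surjective_pairing; apply: (congr2 pair).
  by rewrite (raddf_sum fst) big1 // => k _ /=; rewrite scaler0.
by rewrite (raddf_sum snd).
Qed.
End IdealMul.

(** * Gradings and homogeneous bases obtained from coordinate functions *)

Section Coordinates.
Variables (K : fieldType) (n : nat).
Local Notation E := (exterior K n).
Variables (M : lmodType E) (hom : nat -> M -> Prop) (X : finType).
Variables (b : X -> M) (wt : X -> nat) (coord : M -> X -> E).
Hypothesis coord_lin : forall c x y p, coord (c *: x + y) p = c * coord x p + coord y p.
Hypothesis coord_inj : forall x, (forall p, coord x p = 0) -> x = 0.
Hypothesis coord_b : forall p q, coord (b p) q = (p == q)%:R.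
Hypothesis homP : forall d x, hom d x <->
  forall p A, ecoef (coord x p) A != 0 -> (#|A| + wt p)%N = d.

Lemma coordD x y p : coord (x + y) p = coord x p + coord y p.
Proof. by rewrite -{1}(scale1r x) coord_lin mul1r. Qed.

Lemma coord0 p : coord 0 p = 0.
Proof. by apply: (addrI (coord 0 p)); rewrite -coordD !addr0. Qed.

Lemma coordZ c x p : coord (c *: x) p = c * coord x p.
Proof. by rewrite -[c *: x]addr0 coord_lin coord0 addr0. Qed.

Lemma coord_sum (Y : Type) (r : seq Y) (P : pred Y) (F : Y -> M) p :
  coord (\sum_(i <- r | P i) F i) p = \sum_(i <- r | P i) coord (F i) p.
Proof.
by apply: (big_morph (coord^~ p)) => [x y|]; [apply: coordD|apply: coord0].
Qed.

Lemma coord_comb (c : X -> E) p : coord (\sum_q c q *: b q) p = c p.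
Proof.
rewrite coord_sum (bigD1 p) //= coordZ coord_b eqxx mulr1 big1 ?addr0 // => q qp.
by rewrite coordZ coord_b (negbTE qp) mulr0.
Qed.

Lemma coord_eq x y : coord x =1 coord y -> x = y.
Proof.
move=> h; apply/eqP; rewrite -subr_eq0; apply/eqP/coord_inj => p.
by rewrite addrC -scaleN1r coord_lin h mulN1r addNr.
Qed.

Lemma coord_decomp x : x = \sum_p coord x p *: b p.
Proof. by apply: coord_eq => p; rewrite coord_comb. Qed.

Lemma coord_homog_basis : homog_basis hom b wt.
Proof.
split=> [p|x].
  apply/homP => q A; rewrite coord_b; case: (p =P q) => [<-|_]; last first.
    by rewrite ecoef0 eqxx.
  rewrite [1]/(emono K set0) ecoef_mono; case: (A =P set0) => [->|_]; last first.
    by rewrite eqxx.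
  by rewrite cards0.
exists [ffun p => coord x p]; split=> [|c ->].
  by rewrite {1}[x]coord_decomp; apply: eq_bigr => p _; rewrite ffunE.
by apply/ffunP => p; rewrite ffunE coord_comb.
Qed.

Lemma coord_grading : is_grading hom.
Proof.
split=> [d|d x y /homP hx /homP hy|e d c x hc /homP hx|x|N y hy sy d ltd].
- by apply/homP => p A; rewrite coord0 ecoef0 eqxx.
- apply/homP => p A; rewrite coordD ecoefD.
  have [->|/hx //] := eqVneq (ecoef (coord x p) A) 0.
  by rewrite add0r => /hy.
- apply/homP => p A; rewrite coordZ => /ecoef_mul_neq0[B [C [dBC -> /hc <- /hx <-]]].
  move: dBC; rewrite -setI_eq0 => /eqP dBC.
  by rewrite cardsU dBC cards0 subn0 addnA.
(* [N] exceeds every degree of a term [e_A b_p], and [y d] below gathers the terms of degree exactly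
   [d]. *)
- pose N := (\max_(p : X * {set 'I_n}) (#|p.2| + wt p.1)).+1%N.
  pose y d := \sum_p ([ffun A : {set 'I_n} =>
    (if (#|A| + wt p == d)%N then ecoef (coord x p) A else 0) : K^o] : E) *: b p.
  have yE d p A : ecoef (coord (y d) p) A =
      if (#|A| + wt p == d)%N then ecoef (coord x p) A else 0.
    by rewrite coord_comb /ecoef ffunE.
  exists N, y; split=> [d|].
    by apply/homP => p A; rewrite yE; case: (_ =P d) => // _; rewrite eqxx.
  apply: coord_eq => p; apply: extP => A; rewrite coord_sum ecoef_sum.
  have ltN : (#|A| + wt p < N)%N.
    by rewrite ltnS; apply: (leq_bigmax (p, A)).
  rewrite (bigD1 (Ordinal ltN)) //= yE eqxx big1 ?addr0 // => d nd.
  by rewrite yE; case: eqP => // e; rewrite -val_eqE /= e eqxx in nd.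
apply: coord_inj => p; apply: extP => A; rewrite ecoef0.
apply/eqP; apply: contraT => nz.
(* At a fixed position [(p, A)] only one degree is possible, so no other summand can cancel the
   coefficient of [y d]. *)
have := congr1 (fun z => ecoef (coord z p) A) sy.
rewrite coord_sum ecoef_sum coord0 ecoef0 (bigD1 (Ordinal ltd)) //= big1 ?addr0 => [/eqP|d' nd].
  by rewrite (negbTE nz).
apply/eqP; apply: contraNT nd => nz'.
have /homP/(_ _ _ nz) ed := hy d; have /homP/(_ _ _ nz') ed' := hy d'.
by rewrite -val_eqE /= -ed -ed'.
Qed.
End Coordinates.

(** * Exactness of a mapping cone in positive homological degrees *)

Section ConeExact.
Variables (K : fieldType) (n : nat).
Local Notation E := (exterior K n).
Variables (C F : nat -> lmodType E).
Variables (dC : forall i, {linear C i.+1 -> C i}).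
Variables (dF : forall i, {linear F i.+1 -> F i}).
Variables (psi : forall i, {linear C i -> F i}).
Hypothesis exC : forall i c, dC i c = 0 <-> exists y, c = dC i.+1 y.
Hypothesis exF : forall i x, dF i x = 0 <-> exists y, x = dF i.+1 y.
Hypothesis chain : forall i c, psi i (dC i c) = dF i (psi i.+1 c).
Hypothesis psi_inj : forall c f, psi 0 c = dF 0 f -> exists c', c = dC 0 c'.

(** The long exact sequence, done by hand. The hypothesis [psi_inj] is injectivity of the map
    induced on homology in degree 0; it enters in cone degree 1, where the cycle condition imposes
    no equation inside [C] alone. *)
Lemma cone_exact i (x : cone C F i.+1) :
  cone_diff dC dF psi x = 0 <-> exists y, x = cone_diff dC dF psi (i := i.+1) y.
Proof.
have dCK k c : dC k (dC k.+1 c) = 0 by apply/exC; exists c.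
have dFK k f : dF k (dF k.+1 f) = 0 by apply/exF; exists f.
(* As [psi] is a chain map, the assumption says that [f - psi k.+1 c'] is a cycle of [F], hence a
   boundary. *)
have lift k c' f : psi k (- dC k c') + dF k f = 0 ->
    exists f', f = psi k.+1 c' + dF k.+1 f'.
  rewrite linearN chain addrC -linearB => /exF[f' e].
  by exists f'; rewrite -e addrC subrK.
split=> [|[y ->]]; last first.
  have eF k c f : psi k (- dC k c) + dF k (psi k.+1 c + dF k.+1 f) = 0.
    by rewrite linearN linearD chain dFK addr0 addNr.
  case: i x y => [|i] _ [y1 y2] /=; first exact: eF.
  by rewrite eF linearN dCK !oppr0.
case: i x => [|i] [c f] /= => [h|[/eqP]].
  have [c' ec] : exists c', c = dC 0 c'.
    by apply: (psi_inj (f := - f)); rewrite linearN; apply/eqP; rewrite -addr_eq0 h.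
  have [f' ef] : exists f', f = psi 1 (- c') + dF 1 f'.
    by apply: lift; rewrite [dC _ (- _)]linearN opprK -ec.
  by exists (- c', f'); rewrite /= [dC _ (- _)]linearN opprK -ec -ef.
rewrite oppr_eq0 => /eqP/exC[c' ec] h.
have [f' ef] : exists f', f = psi i.+2 (- c') + dF i.+2 f'.
  by apply: lift; rewrite [dC _ (- _)]linearN opprK -ec.
by exists (- c', f'); rewrite /= [dC _ (- _)]linearN opprK -ec -ef.
Qed.
End ConeExact.

(** * The internal grading of the Cartan complex *)

Section CartanGraded.
Variables (K : fieldType) (n : nat) (S : {set 'I_n}) (s : nat).
Local Notation E := (exterior K n).

Lemma cartan_homogP i d (c : cartan K S i) : cartan_homog s d c <->
  forall a A, ecoef (cext c a) A != 0 -> (#|A| + (mdeg a + s))%N = d.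
Proof.
split=> [H a A nz|H b A nz]; last by apply: H; rewrite cext_idx.
case: (boolP ((mdeg a == i) && (mnm_supp a \subset S))) =>
    [/andP[/eqP da sa]|out].
  by have [b e] := cartan_idxP da sa; rewrite -e; apply: H; rewrite -e cext_idx in nz.
by rewrite cext_out ?ecoef0 ?eqxx in nz.
Qed.

Lemma cartan_homogD i d (c c' : cartan K S i) :
  cartan_homog s d c -> cartan_homog s d c' -> cartan_homog s d (c + c').
Proof.
move=> /cartan_homogP hc /cartan_homogP hc'; apply/cartan_homogP => a A.
rewrite -[c]scale1r cext_linear mul1r ecoefD.
have [->|/hc //] := eqVneq (ecoef (cext c a) A) 0.
by rewrite add0r => /hc'.
Qed.

Lemma cartan_homogN i d (c : cartan K S i) :
  cartan_homog s d c -> cartan_homog s d (- c).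
Proof.
move=> /cartan_homogP hc; apply/cartan_homogP => a A.
by rewrite -[- c]add0r cextB cext0 sub0r ecoefN oppr_eq0 => /hc.
Qed.

Lemma cartan_homog_diff i d (c : cartan K S i.+1) :
  cartan_homog s d c -> cartan_homog s d (cartan_diff (@evar K n) c).
Proof.
move=> /cartan_homogP hc; apply/cartan_homogP => a A.
rewrite cext_diff ecoef_sum => nz.
have [k nzk] : exists k, ecoef (cext c (a + U_(k))%MM * evar K k) A != 0.
  apply: contrapT => no; move/eqP: nz; apply; rewrite big1 // => k _.
  by apply/eqP; apply: contraT => nz; case: no; exists k.
have [B [C [dBC -> /hc <-]]] := ecoef_mul_neq0 nzk.
rewrite ecoef_mono; case: (C =P [set k]) => [eC _|]; last by rewrite eqxx.
move: dBC; rewrite cardsU -setI_eq0 eC => /eqP->; rewrite cards0 subn0 cards1.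
by rewrite mdegD mdeg1 addn1 addn1 addnCA addnS addSn addnS addnCA.
Qed.

Lemma cartan_homog_dpow i a : mdeg a = i -> mnm_supp a \subset S ->
  cartan_homog s (mdeg a + s) (dpow K S i a).
Proof.
move=> da sa; apply/cartan_homogP => a' A; rewrite cext_dpow //.
case: (a =P a') => [<-|_]; last by rewrite ecoef0 eqxx.
rewrite [1]/(emono K set0) ecoef_mono; case: (A =P set0) => [->|]; last by rewrite eqxx.
by rewrite cards0.
Qed.
End CartanGraded.

(** * The iterated mapping cone: bases, exactness and minimality *)

Section ItCone.
Variables (K : fieldType) (n : nat) (us : seq {set 'I_n}).
Local Notation E := (exterior K n).
Local Notation u_ := (nth set0 us).
Local Notation itcone := (itcone K us).

Lemma itcone_homogD j i d (x y : itcone j i) :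
  itcone_homog d x -> itcone_homog d y -> itcone_homog d (x + y).
Proof.
elim: j i x y => [|j IHj] [|i] x y //=.
- move=> hx hy A; rewrite ecoefD.
  have [->|/hx //] := eqVneq (ecoef (x : E) A) 0.
  by rewrite add0r => /hy.
- exact: IHj.
by move=> [hx1 hx2] [hy1 hy2]; split; [apply: cartan_homogD|apply: IHj].
Qed.

(* coefficient of f(a; u_(l+1)) *)
Fixpoint itcone_coef (j i : nat) : itcone j i.+1 -> nat -> 'X_{1..n} -> E :=
  match j return itcone j i.+1 -> nat -> 'X_{1..n} -> E with
  | 0 => fun _ _ _ => 0
  | j'.+1 => fun x l a => if l == j' then cext x.1 a else itcone_coef x.2 l a
  end.

Lemma itcone_coef_linear j i c (x y : itcone j i.+1) l a :
  itcone_coef (c *: x + y) l a = c * itcone_coef x l a + itcone_coef y l a.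
Proof.
elim: j x y => [|j IHj] x y /=; first by rewrite mulr0 addr0.
by case: ifP => _; [apply: cext_linear|apply: IHj].
Qed.

Lemma itcone_coef0 j i l a : itcone_coef (0 : itcone j i.+1) l a = 0.
Proof.
by elim: j => [|j IHj] //=; case: ifP => _; [apply: cext0|apply: IHj].
Qed.

Lemma itcone_coef_inj j i (x : itcone j i.+1) :
  (forall l a, (l < j)%N -> itcone_coef x l a = 0) -> x = 0.
Proof.
elim: j x => [|j IHj] x /= H; first exact: thinmx0.
case: x H => x1 x2 /= H; apply: (congr2 pair).
  by apply: cextP => a; have := H j a (ltnSn j); rewrite eqxx cext0.
apply: IHj => l a ltl; have := H l a (ltnW ltl).
by rewrite ltn_eqF.
Qed.

Lemma itcone_coef_out j i (x : itcone j i.+1) l a :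
  ~~ ((mdeg a == i) && (mnm_supp a \subset lqset K us (u_ l))) ->
  itcone_coef x l a = 0.
Proof.
move=> out; elim: j x => [|j IHj] x //=.
by case: eqP => [lj|_]; [apply: cext_out; rewrite -lj|apply: IHj].
Qed.

Lemma itcone_homogP j i d (x : itcone j i.+1) : itcone_homog d x <->
  forall l a A, (l < j)%N -> ecoef (itcone_coef x l a) A != 0 ->
    (#|A| + (mdeg a + #|u_ l|))%N = d.
Proof.
elim: j x => [|j IHj] x //=; split=> [[/cartan_homogP h1 /IHj h2] l a A|H].
  rewrite ltnS leq_eqVlt; case: eqP => [->|_] /=; first by move=> _ /h1.
  exact: h2.
split; first by apply/cartan_homogP => a A nz; apply: (H j); rewrite ?eqxx.
by apply/IHj => l a A ltl nz; apply: H; rewrite ?ltn_eqF // ltnW.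
Qed.

Hypothesis us_uniq : uniq us.

(** The recursion for [itcone_basis] searches for the generator from the last cone downwards; as
    [us] has no repetition, it stops exactly at position [l]. Positions from [j] on carry the
    default coefficient 0. *)
Lemma itcone_coef_basis j i l l' a a' : (j <= size us)%N -> (l < j)%N ->
    mdeg a = i -> mnm_supp a \subset lqset K us (u_ l) ->
  itcone_coef (itcone_basis K us j i.+1 a (u_ l)) l' a' =
    if (l' < j)%N then ((l == l') && (a == a'))%:R else 0.
Proof.
move=> + + da; elim: j => [|j IHj] //= jus lj sa.
have lus : (l < size us)%N := leq_trans lj jus.
rewrite nth_uniq // eq_sym ltnS [(l' <= j)%N]leq_eqVlt.
case: (eqVneq l j) lj => [elj _|nlj] /=.
  subst l; rewrite [j == l']eq_sym; case: eqP => [->|_] /=; first by rewrite cext_dpow.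
  by rewrite itcone_coef0 if_same.
rewrite ltnS leq_eqVlt (negbTE nlj) /= => lj.
case: (eqVneq l' j) => [->|nlj'] /=; last by apply: IHj => //; apply: ltnW.
by rewrite (negbTE nlj) cext0.
Qed.

(** Coning never changes the module in homological degree 0, so the augmentation serves as its
    single coordinate. *)
Lemma itcone0_basis j :
  is_grading (@itcone_homog K n us j 0) /\
  exists b, homog_basis (@itcone_homog K n us j 0) (fun _ : unit => b) (fun=> 0%N).
Proof.
have [b aug_b] : exists b : itcone j 0, itcone_aug K us j b = 1.
  by elim: j => [|j IHj] //=; exists 1.
pose coord x (_ : unit) : E := itcone_aug K us j x.
have coord_lin c x y p : coord (c *: x + y) p = c * coord x p + coord y p.
  by rewrite /coord linearP.
have coord_inj x : (forall p, coord x p = 0) -> x = 0.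
  move=> /(_ tt); rewrite /coord; clear.
  by elim: j x => [|j IHj] x //=; apply: IHj.
have coord_b p q : coord b q = (p == q)%:R.
  by rewrite /coord aug_b; case: p q => [] [].
have homP d x : itcone_homog d x <->
    forall p A, ecoef (coord x p) A != 0 -> (#|A| + 0)%N = d.
  have -> : itcone_homog d x = ehomog d (itcone_aug K us j x : E).
    by clear; elim: j x.
  by split=> [H _ A /H|H A /(H tt)]; rewrite addn0.
split; first exact: (coord_grading coord_lin coord_inj coord_b homP).
by exists b; apply: (coord_homog_basis coord_lin coord_inj coord_b homP).
Qed.

(** The functions [itcone_coef], restricted to the admissible pairs of exponent and generator,
    satisfy the assumptions on coordinates made above. *)
Lemma itconeS_basis i :
  is_grading (@itcone_homog K n us (size us) i.+1) /\
  homog_basis (@itcone_homog K n us (size us) i.+1)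
    (fun p : basis_idx K us i.+1 =>
       itcone_basis K us (size us) i.+1 (bmnm (val p).1) (val p).2)
    (fun p : basis_idx K us i.+1 => (mdeg (bmnm (val p).1) + #|(val p).2|)%N).
Proof.
pose coord (x : itcone (size us) i.+1) (p : basis_idx K us i.+1) : E :=
  itcone_coef x (index (val p).2 us) (bmnm (val p).1).
have coord_lin c x y p : coord (c *: x + y) p = c * coord x p + coord y p.
  exact: itcone_coef_linear.
have idxP l a : (l < size us)%N -> mdeg a = i -> mnm_supp a \subset lqset K us (u_ l) ->
    exists2 p : basis_idx K us i.+1, bmnm (val p).1 = a & (val p).2 = u_ l.
  move=> ltl da sa; have lt_a : (mdeg a < i.+1)%N by rewrite da.
  have Pp : [&& u_ l \in us, mnm_supp (BMultinom lt_a) \subset lqset K us (u_ l)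
                & mdeg (BMultinom lt_a) == i].
    by rewrite mem_nth // sa /= da eqxx.
  by exists (exist _ (BMultinom lt_a, u_ l) Pp).
(* Coefficients outside the index type vanish, so conditions on all positions and exponents reduce
   to conditions on coordinates. *)
have coord_at x l a : (l < size us)%N -> itcone_coef x l a <> 0 ->
    exists p, [/\ coord x p = itcone_coef x l a, bmnm (val p).1 = a & (val p).2 = u_ l].
  move=> ltl nz.
  case: (boolP ((mdeg a == i) && (mnm_supp a \subset lqset K us (u_ l)))) =>
    [/andP[/eqP da sa]|out]; last by case: nz; apply: itcone_coef_out.
  have [p pa pl] := idxP _ _ ltl da sa; exists p.
  by rewrite /coord pl index_uniq // pa.
have pP (p : basis_idx K us i.+1) : [/\ (val p).2 \in us,
    mdeg (bmnm (val p).1) = i & mnm_supp (bmnm (val p).1) \subset lqset K us (val p).2].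
  by case: p => p /= /and3P[? ? /eqP].
have coord_inj x : (forall p, coord x p = 0) -> x = 0.
  move=> x0; apply: itcone_coef_inj => l a ltl; apply: contrapT => nz.
  by have [p [e _ _]] := coord_at _ _ _ ltl nz; apply: nz; rewrite -e.
have coord_b p q : coord (itcone_basis K us (size us) i.+1 (bmnm (val p).1) (val p).2) q
    = (p == q)%:R.
  have [p2 dp sp] := pP p; have [q2 _ _] := pP q.
  rewrite /coord -{1}(nth_index set0 p2) itcone_coef_basis ?index_mem ?nth_index // q2.
  congr (nat_of_bool _)%:R; apply/andP/eqP => [[/eqP/(congr1 u_) + /eqP e1]|-> //].
  rewrite !nth_index // => e2.
  by apply/val_inj/eqP; rewrite -pair_eqE /pair_eq /= e2 eqxx andbT -val_eqE /= e1.
have homP d x : itcone_homog d x <-> forall p A, ecoef (coord x p) A != 0 ->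
    (#|A| + (mdeg (bmnm (val p).1) + #|(val p).2|))%N = d.
  rewrite itcone_homogP; split=> H => [p A nz|l a A ltl nz].
    have [p2 _ _] := pP p; rewrite -{1}(nth_index set0 p2).
    by apply: H; rewrite ?index_mem.
  have [|p [e <- <-]] := coord_at x _ a ltl.
    by move=> e; rewrite e ecoef0 eqxx in nz.
  by apply: H; rewrite e.
split; first exact: (coord_grading coord_lin coord_inj coord_b homP).
exact: (coord_homog_basis coord_lin coord_inj coord_b homP).
Qed.

(** An element of degree above those of all basis elements has coefficients of positive degree. The
    generator in homological degree 0 has degree 0; those in degree [i > 0] have degree
    [#|u_ l| + i.-1]. *)
Lemma itcone_homog_ideal j i d (x : itcone j i) : (0 < d)%N ->
    (forall l, (l < j)%N -> (0 < i)%N -> (#|u_ l| + i.-1 < d)%N) ->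
  itcone_homog d x -> ideal_mul (evar_gen [set: 'I_n]) x.
Proof.
move=> d0; have idm : is_ideal (evar_gen (K := K) [set: 'I_n]) by apply: is_ideal_gen.
elim: j i x => [|j IHj] [|i] /= x lt_d.
- move=> hx; rewrite -[x]mulr1; apply: (ideal_mulS (M := E^o)).
  apply/evar_genT/eqP; apply: contraT => /hx; rewrite cards0 => d0'.
  by rewrite -d0' in d0.
- by move=> _; rewrite [x]thinmx0; apply: ideal_mul0.
- by apply: IHj => l ltl.
move=> [/= h1 h2]; rewrite [x]surjective_pairing; apply: ideal_mul_pair => //; last first.
  by apply: IHj => // l ltl; apply: lt_d; apply: ltnW.
rewrite (cartan_decomp x.1); apply: ideal_mul_sum => // b _; apply: ideal_mulS.
apply/evar_genT/eqP; apply: contraT => /h1; rewrite cards0 mdeg_idx add0n => e.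
by have := lt_d j (ltnSn j) isT; rewrite -e addnC ltnn.
Qed.

Variable (psi : forall j i, {linear cartan_at K us j i -> itcone j i}).
Hypothesis psiP : forall j, (j < size us)%N -> comparison psi j.

(** A set of variables is determined by the ideal it generates, so the set supplied by
    [linear_quotients] must be [lqset]. *)
Lemma lqset_colon j x : linear_quotients K us -> (j < size us)%N ->
  colon (partial_ideal us j) (emono K (u_ j)) x <-> evar_gen (lqset K us (u_ j)) x.
Proof.
move=> lq jus; have [S HS] := lq _ jus.
suff -> : lqset K us (u_ j) = S by apply: HS.
apply/setP => k; rewrite inE index_uniq //.
by apply/asboolP/idP => [/HS/evar_in_gen|/evar_in_gen/HS].
Qed.

Lemma itcone_diff_homog j i k (x : itcone j i.+1) : (j <= size us)%N ->
  itcone_homog k x -> itcone_homog k (itcone_diff psi j i x).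
Proof.
elim: j i x => [|j IHj] [|i] x jus /=.
- by move=> _ A; rewrite ecoef0 eqxx.
- by [].
- move=> [h1 h2]; apply: itcone_homogD; last by apply: IHj => //; apply: ltnW.
  exact: (comparison_homog (psiP jus)).
move=> [h1 h2]; split; first by apply: cartan_homogN; apply: cartan_homog_diff.
apply: itcone_homogD; last by apply: IHj => //; apply: ltnW.
exact: (comparison_homog (psiP jus)).
Qed.

Lemma partial_idealS j x : (j < size us)%N ->
  partial_ideal us j.+1 x <->
  exists y w : E, partial_ideal us j y /\ x = y + w * emono K (u_ j).
Proof. by move=> jus; rewrite /partial_ideal (take_nth set0 jus); apply: mono_gen_rcons. Qed.

(** The two claims are proved in one induction: exactness at degree 0 identifies the cokernel with
    the quotient by the partial ideal, and there multiplication by the next generator is injective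
    modulo the colon ideal, as [cone_exact] requires. *)
Lemma itcone_exact j : linear_quotients K us -> (j <= size us)%N ->
  (forall i (x : itcone j i.+1), itcone_diff psi j i x = 0 <->
     exists y, x = itcone_diff psi j i.+1 y) /\
  (forall x : itcone j 0, partial_ideal us j (itcone_aug K us j x) <->
     exists y, x = itcone_diff psi j 0 y).
Proof.
move=> lq; elim: j => [_|j IHj jus].
  split=> [i x|x]; first by split=> // _; exists 0; rewrite [x]thinmx0.
  rewrite /partial_ideal take0; split=> [/mono_genP H|[y ->] /=].
    exists 0; apply: extP => A; rewrite ecoef0; apply/eqP; apply: contraT => /H[u].
    by rewrite inE.
  by apply: ideal0; apply: is_ideal_gen.
have [exF exF0] := IHj (ltnW jus).
have idl k : is_ideal (@partial_ideal K n us k) by apply: is_ideal_gen.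
have augP c : partial_ideal us j
    (itcone_aug K us j (psi j 0 c) - cext c 0%MM * emono K (u_ j)).
  by rewrite {1}[c]cartan0_dpow; apply: (comparison_lift (psiP jus)).
have idB k x y : partial_ideal us k x -> partial_ideal us k y -> partial_ideal us k (x - y : E).
  move=> hx hy; apply: (idealD (idl k)) => //.
  by rewrite -mulN1r; apply: (Defs.idealMl (idl k)).
split.
  apply: cone_exact => // [i c|c|c f e].
  - exact: cartan_exact.
  - exact: (comparison_chain (psiP jus)).
  (* If [psi j 0 c] is a boundary, its augmentation lies in the partial ideal; hence so does the
     coefficient of [c] times [u_ j], which places that coefficient in the colon ideal. *)
  apply/cartan_exact0/lqset_colon => //; rewrite /colon.
  have -> : cext c 0%MM * emono K (u_ j) = itcone_aug K us j (psi j 0 c) -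
      (itcone_aug K us j (psi j 0 c) - cext c 0%MM * emono K (u_ j)).
    by rewrite opprB addrC subrK.
  by apply: idB => //; apply/exF0; exists f.
move=> x; rewrite partial_idealS //; split=> [[y [w [Iy e]]]|[[c f] -> /=]].
  have {}e : itcone_aug K us j x = y + w * emono K (u_ j) := e.
  (* The summand [w * emono K (u_ j)] is hit by [w] times the generator of the new Cartan complex;
     the rest lies in the previous ideal and comes from the previous cone. *)
  pose c : cartan_at K us j 0 := w *: dpow K _ 0 0%MM.
  have c0 : cext c 0%MM = w.
    rewrite -[c]addr0 cext_linear cext0 addr0 cext_dpow ?mdeg0 ?eqxx ?mulr1 //.
    by apply/subsetP => k; rewrite inE mnm0E eqxx.
  have [f ef] : exists f, x - psi j 0 c = itcone_diff psi j 0 f.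
    apply/exF0; have := idB _ _ _ Iy (augP c); rewrite c0 opprB addrA -e.
    by rewrite -[itcone_aug K us j x - _]linearB.
  by exists (c, f); rewrite /= -ef addrC subrK.
exists (itcone_aug K us j (itcone_diff psi j 0 f) +
  (itcone_aug K us j (psi j 0 c) - cext c 0%MM * emono K (u_ j))), (cext c 0%MM).
split; first by apply: (idealD (idl j)) => //; apply/exF0; exists f.
by rewrite linearD /= addrA subrK addrC.
Qed.

(** Cartan differentials have variables as coefficients, so only the comparison maps need the degree
    argument. Excluding [set0] makes the generators of positive degree, which settles homological
    degree 0. *)
Lemma itcone_minimal j : set0 \notin us -> degree_increasing us -> (j <= size us)%N ->
  minimal_complex (itcone_diff psi j).
Proof.
move=> us0 incr.
have idm : is_ideal (evar_gen (K := K) [set: 'I_n]) by apply: is_ideal_gen.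
elim: j => [|j IHj] jus i x; first exact: ideal_mul0.
have min_psi k (c : cartan_at K us j k) : ideal_mul (evar_gen [set: 'I_n]) (psi j k c).
  rewrite (cartan_decomp c) linear_sum; apply: ideal_mul_sum => // b _.
  rewrite linearZ; apply: ideal_mulZ => //.
  have hb := @cartan_homog_dpow K n _ #|u_ j| _ _ (mdeg_idx b) (supp_idx b).
  have u_gt0 : (0 < #|u_ j|)%N.
    rewrite lt0n cards_eq0; apply: contraNneq us0 => <-; exact: mem_nth.
  apply: itcone_homog_ideal (comparison_homog (psiP jus) hb) => [|l ltl k0].
    by rewrite addn_gt0 u_gt0 orbT.
  (* Degrees of generators need only increase weakly: the strict inequality comes from the shift
     [k.-1 < k]. *)
  rewrite mdeg_idx addnC -(prednK k0) addSn ltnS leq_add2l.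
  apply: (sorted_leq_nth _ _ set0 incr) => //; rewrite ?inE ?(ltn_trans ltl) //.
  - by move=> v u w; apply: leq_trans.
  - exact: ltnW.
case: i x => [|i] [c f] /=.
  by apply: ideal_mulD => //; apply: IHj; apply: ltnW.
apply: ideal_mul_pair => //; last first.
  by apply: ideal_mulD => //; apply: IHj; apply: ltnW.
rewrite -scaleN1r; apply: ideal_mulZ => //; apply: ideal_mul_sum => // b _.
apply: ideal_mulZ => //; apply: ideal_mul_sum => // k _; apply: ideal_mulS.
by apply/evar_in_gen; rewrite inE.
Qed.
End ItCone.

Theorem theorem3p1 (K : fieldType) (n : nat) (I : exterior K n -> Prop)
    (us : seq {set 'I_n})
    (psi : forall j i, {linear cartan_at K us j i -> itcone K us j i}) :
  monomial_ideal I ->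
  (exists x, ~ I x) ->
  uniq us ->
  min_mono_gens I [set u in us] ->
  linear_quotients K us ->
  degree_increasing us ->
  (forall j, (j < size us)%N -> comparison psi j) ->
  [/\ graded_free_resolution (@itcone_homog K n us (size us))
        (itcone_diff psi (size us)) (itcone_aug K us (size us)) I,
      minimal_complex (itcone_diff psi (size us))
    & forall i, (0 < i)%N ->
        homog_basis (@itcone_homog K n us (size us) i)
          (fun p : basis_idx K us i =>
             itcone_basis K us (size us) i (bmnm (val p).1) (val p).2)
          (fun p : basis_idx K us i =>
             (mdeg (bmnm (val p).1) + #|(val p).2|)%N)].
Proof.
move=> _ [x0 nIx0] us_uniq [genI _] lq incr psiP.
(* The empty monomial is the unit, so having it as a generator would contradict properness of
   [I]. *)
have us0 : set0 \notin us.
  apply/negP => us0; apply: nIx0; apply/genI/mono_genP => A _.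
  by exists set0; rewrite ?inE ?sub0set.
have I_size x : I x <-> partial_ideal us (size us) x.
  by rewrite /partial_ideal take_size.
have [ex ex0] := itcone_exact us_uniq psiP lq (leqnn _).
split; last 1 first.
- by case=> // i _; case: (itconeS_basis K us_uniq i).
- split.
  + by case=> [|i]; [case: (itcone0_basis K us (size us))|case: (itconeS_basis K us_uniq i)].
  + case=> [|i]; last by case: (itconeS_basis K us_uniq i) => _ hb; do 3 eexists; exact: hb.
    by case: (itcone0_basis K us (size us)) => _ [b hb]; do 3 eexists; exact: hb.
  + by move=> i k x; apply: itcone_diff_homog.
  + exact: ex.
  + move=> k x; clear; elim: (size us) x => [|j IHj] x //=; exact: IHj.
  + by move=> x; rewrite I_size.
  + move=> z; have [x xz] : exists x, itcone_aug K us (size us) x = z.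
      by clear; elim: (size us) => [|j IHj] //=; exists z.
    by exists x; rewrite xz subrr; apply/I_size; exact: ideal0 (is_ideal_gen _).
exact: (itcone_minimal psiP us0 incr).
Qed.
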